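(* Every $S3^\forall_\equiv$-model is an admissible simple model.
   Context: Language: $Fm(C)$ is the set of formulas built from propositional variables $V$, a set $C$ of constants containing $\top,\bot$, connectives $\neg,\rightarrow,\vee,\wedge$, identity connective $\equiv$, necessity $\square$ and universal propositional quantifier $\forall$ ($\forall x\varphi$ formed only if $x$ free in $\varphi$). $\varphi[\sigma]$ is capture-avoiding application of a substitution $\sigma\colon V\to Fm(C)$; $=_\alpha$ is alpha-congruence. $\mathbb{AX}^-$ is the smallest set containing all formulas of the forms: (i) substitution-instances of propositional tautologies; (ii) $\square\varphi\rightarrow\varphi$; (iii) $\square(\varphi\rightarrow\psi)\rightarrow(\square\varphi\rightarrow\square\psi)$; (iv) $\square(\varphi\rightarrow\psi)\rightarrow\square(\square\varphi\rightarrow\square\psi)$; (v) $\varphi\equiv\psi$ if $\varphi=_\alpha\psi$; (vi) $(\varphi\equiv\psi)\rightarrow(\varphi\rightarrow\psi)$; (vii) $(\psi\equiv\psi')\rightarrow(\varphi[x:=\psi]\equiv\varphi[x:=\psi'])$, $x$ free in $\varphi$; (ix) $\forall x\varphi\rightarrow\varphi[x:=\psi]$; (x) $\forall x(\varphi\rightarrow\psi)\rightarrow(\forall x\varphi\rightarrow\forall x\psi)$; (xi) $\forall x(\varphi\rightarrow\psi)\rightarrow(\varphi\rightarrow\forall x\psi)$, $x$ not free in $\varphi$; (xii) $\square\forall x\varphi\rightarrow\forall x\square\varphi$; and closed under: $\varphi\in\mathbb{AX}^-$ and $x$ free in $\varphi$ implies $\forall x\varphi\in\mathbb{AX}^-$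 (i.e. it omits $\forall x(\varphi\equiv\psi)\rightarrow(\forall x\varphi\equiv\forall x\psi)$ and the Barcan formula $\forall x\square\varphi\rightarrow\square\forall x\varphi$). $S3^\forall_\equiv$-models: a propositional domain is $\mathcal{M}=(M,\mathit{TRUE},\mathit{NEC},f_\bot,f_\top,f_\square,f_\neg,f_\vee,f_\wedge,f_\rightarrow,f_\equiv,f_\forall,\varGamma)$ with $\mathit{TRUE},\mathit{NEC}\subseteq M$, operations of obvious arities, $f_\forall\colon M^M\to M$, $\varGamma\colon C\to M$ with $\varGamma(\bot)=f_\bot,\varGamma(\top)=f_\top$; assignments $\gamma\colon V\to M$ extend homomorphically with $\gamma(c)=\varGamma(c)$ and $\gamma(\forall x\varphi)=f_\forall(m\mapsto\gamma_x^m(\varphi))$. $t\colon M\to M$ is $(\varphi,x,\gamma)$-definable if $t(m)=\gamma_x^m(\varphi)$ for all $m$ (definable if so for some $\varphi,x,\gamma$). With $a\le_\mathcal{M}b:\Leftrightarrow f_\rightarrow(a,b)\in\mathit{NEC}$ and $\approx_\mathcal{M}$ its symmetric part, $\mathcal{M}$ is an $S3^\forall_\equiv$-model if: (1) when $\mathit{NEC}\neq\varnothing$, $\le_\mathcal{M}$ is a preorder making $(M,f_\bot,f_\top,f_\neg,f_\vee,f_\wedge,f_\rightarrow,\le_\mathcal{M})$ a Boolean prealgebra ($\approx_\mathcal{M}$ a congruence with Boolean-algebra quotient ordered by $\le_\mathcal{M}$); (2) $f_\bot\notin\mathit{TRUE}$, $f_\top\in\mathit{TRUE}$, classical truth conditions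 for $f_\rightarrow,f_\neg,f_\wedge,f_\vee$, $f_\square(a)\in\mathit{TRUE}\Leftrightarrow a\in\mathit{NEC}$, $f_\equiv(a,b)\in\mathit{TRUE}\Leftrightarrow a=b$, $f_\forall(t)\in\mathit{TRUE}$ for definable $t$ with image in $\mathit{TRUE}$; (3) when $\mathit{NEC}\neq\varnothing$, $\mathit{NEC}\subseteq\mathit{TRUE}$ is upward closed under $\le_\mathcal{M}$ and closed under $f_\wedge$; (4) when $\mathit{NEC}\neq\varnothing$: $f_\top\le_\mathcal{M}f_\equiv(a,a)$; $f_\equiv(a,b)\le_\mathcal{M}f_\rightarrow(a,b)$; $f_\equiv(a,b)\le_\mathcal{M}f_\equiv(t(a),t(b))$ for definable $t$; $f_\square(a)\le_\mathcal{M}a$; $f_\square(f_\rightarrow(a,b))\le_\mathcal{M}f_\rightarrow(f_\square(a),f_\square(b))$; $f_\square(f_\rightarrow(a,b))\le_\mathcal{M}f_\square(f_\rightarrow(f_\square(a),f_\square(b)))$; $f_\forall(t)\le_\mathcal{M}f_\equiv(f_\forall(t_1),f_\forall(t_2))$ and $f_\forall(t)\le_\mathcal{M}f_\rightarrow(f_\forall(t_1),f_\forall(t_2))$ for $t_1,t_2$ $(\varphi,x,\gamma)$-, $(\psi,x,\gamma)$-definable and $t$ the pointwise $f_\equiv$, resp. $f_\rightarrow$, of $t_1,t_2$; $f_\forall(t)\le_\mathcal{M}t(a)$ for definable $t$; $f_\forall(t)\le_\mathcal{M}f_\rightarrow(b,f_\forall(t'))$ for $t'$ $(\psi,x,\gamma)$-definable,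 $b$ the denotation of a sentence and $t(a)=f_\rightarrow(b,t'(a))$; $f_\square(f_\forall(t))\approx_\mathcal{M}f_\forall(a\mapsto f_\square(t(a)))$ for definable $t$; $f_\forall(t)\in\mathit{NEC}$ for definable $t$ with image in $\mathit{NEC}$. Simple models: $(M,\mathit{TRUE},\mathit{NEC},\varGamma)$ with $\mathit{NEC}\subseteq\mathit{TRUE}\subseteq M$, $\varGamma\colon C\to M$, where each assignment $\gamma\colon V\to M$ is extended to some $\gamma\colon Fm(C)\to M$ such that: $\gamma(c)=\varGamma(c)$; if $\gamma,\gamma'$ agree on the free variables of $\varphi$ then $\gamma(\varphi)=\gamma'(\varphi)$; $\gamma(\varphi[\sigma])=\gamma\sigma(\varphi)$ where $\gamma\sigma(x)=\gamma(\sigma(x))$; and for all $\gamma,\varphi,\psi$: $\varGamma(\bot)\notin\mathit{TRUE}$, $\varGamma(\top)\in\mathit{TRUE}$; classical truth conditions for $\rightarrow,\neg,\wedge,\vee$; $\gamma(\square\varphi)\in\mathit{TRUE}\Leftrightarrow\gamma(\varphi)\in\mathit{NEC}$; $\gamma(\varphi\equiv\psi)\in\mathit{TRUE}\Leftrightarrow\gamma(\varphi)=\gamma(\psi)$; $\gamma(\forall x\varphi)\in\mathit{TRUE}\Leftrightarrow\gamma_x^a(\varphi)\in\mathit{TRUE}$ for all $a\in M$; if $\gamma(\varphi\rightarrow\psi)\in\mathit{NEC}$ then $\gamma(\square\varphi\rightarrow\square\psi)\in\mathit{NEC}$; if $\gamma(\forall x\varphi)\in\mathit{NEC}$ then $\gamma_x^a(\varphi)\in\mathit{NEC}$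 for all $a$. A simple model is admissible if every assignment $\gamma$ satisfies $\gamma(\varphi)\in\mathit{NEC}$ for all $\varphi\in\mathbb{AX}^-$.
   Formalization: Proved for models with NEC nonempty (with NEC empty no model is admissible), and with b in the law f_∀(t) ≤ f_→(b, f_∀(t')) the denotation of any formula, not only of a closed one (otherwise axiom (xi) can fail to be necessary). *)

(* Defs.v *)
From mathcomp Require Import all_boot.

Set Implicit Arguments.
Unset Strict Implicit.
Unset Printing Implicit Defensive.

(** * Language *)

Record constants := Constants {
  const_sort :> Type;
  c_top : const_sort;
  c_bot : const_sort;
  c_top_neq_bot : c_top <> c_bot }.

(* The set V of propositional variables. *)
Notation var := nat (only parsing).

Definition upd (T : Type) (f : var -> T) (x : var) (a : T) : var -> T :=
  fun y => if y == x then a else f y.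

(* Expressions in which the quantifier may also be vacuous; [Fm] below is the
   subset in which every subexpression [RAll x phi] has [x] free in [phi]. *)
Inductive raw (C : Type) : Type :=
| RVar of var
| RConst of C
| RNeg of raw C
| RImp of raw C & raw C
| ROr of raw C & raw C
| RAnd of raw C & raw C
| REqu of raw C & raw C
| RBox of raw C
| RAll of var & raw C.

Arguments RVar {C} _.

Fixpoint fv (C : Type) (phi : raw C) : seq var :=
  match phi with
  | RVar x => [:: x]
  | RConst _ => [::]
  | RNeg p | RBox p => fv p
  | RImp p q | ROr p q | RAnd p q | REqu p q => fv p ++ fv q
  | RAll x p => [seq z <- fv p | z != x]
  end.

Fixpoint wf (C : Type) (phi : raw C) : bool :=
  match phi with
  | RVar _ | RConst _ => true
  | RNeg p | RBox p => wf p
  | RImp p q | ROr p q | RAnd p q | REqu p q => wf p && wf q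
  | RAll x p => (x \in fv p) && wf p
  end.

Record Fm (C : Type) := MkFm { fm_raw :> raw C; fm_wf : wf fm_raw }.

(* The least variable greater than all elements of [s]. *)
Definition fresh (s : seq var) : var := \max_(u <- s) u.+1.

(* Capture-avoiding simultaneous substitution. A bound variable is renamed only
   if it would capture a free variable of some [sigma u], [u] free in the
   quantified formula. *)
Fixpoint rsubst (C : Type) (sigma : var -> raw C) (phi : raw C) : raw C :=
  match phi with
  | RVar x => sigma x
  | RConst c => RConst c
  | RNeg p => RNeg (rsubst sigma p)
  | RImp p q => RImp (rsubst sigma p) (rsubst sigma q)
  | ROr p q => ROr (rsubst sigma p) (rsubst sigma q)
  | RAnd p q => RAnd (rsubst sigma p) (rsubst sigma q)
  | REqu p q => REqu (rsubst sigma p) (rsubst sigma q)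
  | RBox p => RBox (rsubst sigma p)
  | RAll x p =>
      let s := flatten [seq fv (sigma u) | u <- fv (RAll x p)] in
      let y := if x \in s then fresh s else x in
      RAll y (rsubst (upd sigma x (RVar y)) p)
  end.

Lemma freshP (s : seq var) : fresh s \notin s.
Proof.
apply/negP => fs.
have := @leq_bigmax_seq _ s xpredT succn _ fs isT.
by rewrite -/(fresh s) ltnn.
Qed.

Lemma fv_rsubst (C : Type) (phi : raw C) (sigma : var -> raw C) (x z : var) :
  x \in fv phi -> z \in fv (sigma x) -> z \in fv (rsubst sigma phi).
Proof.
elim: phi sigma => [y|c|p IHp|p IHp q IHq|p IHp q IHq|p IHp q IHq|p IHp q IHq
  |p IHp|y p IHp] sigma //=; rewrite ?mem_cat.
- by rewrite inE => /eqP->.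
- exact: IHp.
- by move=> /orP[xp|xq] zx; rewrite ?(IHp _ xp) ?(IHq _ xq) ?orbT.
- by move=> /orP[xp|xq] zx; rewrite ?(IHp _ xp) ?(IHq _ xq) ?orbT.
- by move=> /orP[xp|xq] zx; rewrite ?(IHp _ xp) ?(IHq _ xq) ?orbT.
- by move=> /orP[xp|xq] zx; rewrite ?(IHp _ xp) ?(IHq _ xq) ?orbT.
- exact: IHp.
move=> xyp zx; set s := flatten _.
have zs : z \in s by apply/flattenP; exists (fv (sigma x)) => //; exact: map_f.
move: xyp; rewrite !mem_filter => /andP[xy xp]; apply/andP; split.
  case: ifP => ys; apply: contraL zs => /eqP->; last by rewrite ys.
  exact: freshP.
by apply: IHp xp _; rewrite /upd (negPf xy).
Qed.

Lemma wf_rsubst (C : Type) (phi : raw C) (sigma : var -> raw C) :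
  (forall x, wf (sigma x)) -> wf phi -> wf (rsubst sigma phi).
Proof.
elim: phi sigma => [y|c|p IHp|p IHp q IHq|p IHp q IHq|p IHp q IHq|p IHp q IHq
  |p IHp|y p IHp] sigma //= ws; rewrite ?ws //.
- exact: IHp.
- by case/andP=> wp wq; rewrite IHp ?IHq.
- by case/andP=> wp wq; rewrite IHp ?IHq.
- by case/andP=> wp wq; rewrite IHp ?IHq.
- by case/andP=> wp wq; rewrite IHp ?IHq.
- exact: IHp.
case/andP=> yp wp; apply/andP; split.
  by apply: fv_rsubst yp _; rewrite /upd eqxx inE.
by apply: IHp => // x; rewrite /upd; case: ifP.
Qed.

Definition Var (C : Type) (x : var) : Fm C := @MkFm C (RVar x) isT.
Arguments Var {C} x.

Definition Const (C : Type) (c : C) : Fm C := @MkFm C (RConst c) isT.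

Definition Neg (C : Type) (p : Fm C) : Fm C := @MkFm C (RNeg p) (fm_wf p).

Definition Box (C : Type) (p : Fm C) : Fm C := @MkFm C (RBox p) (fm_wf p).

Definition Imp (C : Type) (p q : Fm C) : Fm C :=
  @MkFm C (RImp p q) (introT andP (conj (fm_wf p) (fm_wf q))).

Definition Or (C : Type) (p q : Fm C) : Fm C :=
  @MkFm C (ROr p q) (introT andP (conj (fm_wf p) (fm_wf q))).

Definition And (C : Type) (p q : Fm C) : Fm C :=
  @MkFm C (RAnd p q) (introT andP (conj (fm_wf p) (fm_wf q))).

Definition Equ (C : Type) (p q : Fm C) : Fm C :=
  @MkFm C (REqu p q) (introT andP (conj (fm_wf p) (fm_wf q))).

Definition All (C : Type) (x : var) (p : Fm C) (xp : x \in fv p) : Fm C :=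
  @MkFm C (RAll x p) (introT andP (conj xp (fm_wf p))).

Definition Subst (C : Type) (sigma : var -> Fm C) (p : Fm C) : Fm C :=
  @MkFm C (rsubst (fun x => sigma x) p)
    (wf_rsubst (fun x => fm_wf (sigma x)) (fm_wf p)).

(* [Subst1 x q p] is p[x := q]. *)
Definition Subst1 (C : Type) (x : var) (q p : Fm C) : Fm C :=
  Subst (upd Var x q) p.

(* Alpha-congruence: the least congruence identifying forall x phi with
   forall y phi[x := y] for y not free in forall x phi. *)
Inductive alpha (C : Type) : Fm C -> Fm C -> Prop :=
| alpha_refl p : alpha p p
| alpha_sym p q : alpha p q -> alpha q p
| alpha_trans p q r : alpha p q -> alpha q r -> alpha p r
| alpha_neg p p' : alpha p p' -> alpha (Neg p) (Neg p')
| alpha_box p p' : alpha p p' -> alpha (Box p) (Box p')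
| alpha_imp p p' q q' :
    alpha p p' -> alpha q q' -> alpha (Imp p q) (Imp p' q')
| alpha_or p p' q q' : alpha p p' -> alpha q q' -> alpha (Or p q) (Or p' q')
| alpha_and p p' q q' :
    alpha p p' -> alpha q q' -> alpha (And p q) (And p' q')
| alpha_equ p p' q q' :
    alpha p p' -> alpha q q' -> alpha (Equ p q) (Equ p' q')
| alpha_all (x : var) (p p' : Fm C) (xp : x \in fv p) (xp' : x \in fv p') :
    alpha p p' -> alpha (All xp) (All xp')
| alpha_rename (x y : var) (p : Fm C) (xp : x \in fv p)
    (yp : y \in fv (Subst1 x (Var y) p)) :
    y \notin fv (All xp) -> alpha (All xp) (All yp).

(** * The axioms *)

Inductive pform : Type :=
| PVar of var
| PTop
| PBot
| PNeg of pform
| PImp of pform & pform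
| POr of pform & pform
| PAnd of pform & pform.

Fixpoint peval (v : var -> bool) (a : pform) : bool :=
  match a with
  | PVar x => v x
  | PTop => true
  | PBot => false
  | PNeg a => ~~ peval v a
  | PImp a b => peval v a ==> peval v b
  | POr a b => peval v a || peval v b
  | PAnd a b => peval v a && peval v b
  end.

Definition tautology (a : pform) : Prop := forall v, peval v a.

Fixpoint pinst (C : constants) (sigma : var -> Fm C) (a : pform) : Fm C :=
  match a with
  | PVar x => sigma x
  | PTop => Const (c_top C)
  | PBot => Const (c_bot C)
  | PNeg a => Neg (pinst sigma a)
  | PImp a b => Imp (pinst sigma a) (pinst sigma b)
  | POr a b => Or (pinst sigma a) (pinst sigma b)
  | PAnd a b => And (pinst sigma a) (pinst sigma b)
  end.

Inductive AXm (C : constants) : Fm C -> Prop :=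
| ax_taut a sigma : tautology a -> AXm (pinst sigma a)
| ax_T p : AXm (Imp (Box p) p)
| ax_K p q : AXm (Imp (Box (Imp p q)) (Imp (Box p) (Box q)))
| ax_S3 p q : AXm (Imp (Box (Imp p q)) (Box (Imp (Box p) (Box q))))
| ax_alpha p q : alpha p q -> AXm (Equ p q)
| ax_equ_imp p q : AXm (Imp (Equ p q) (Imp p q))
| ax_equ_subst (x : var) (p q q' : Fm C) : x \in fv p ->
    AXm (Imp (Equ q q') (Equ (Subst1 x q p) (Subst1 x q' p)))
| ax_inst (x : var) (p q : Fm C) (xp : x \in fv p) :
    AXm (Imp (All xp) (Subst1 x q p))
| ax_all_imp (x : var) (p q : Fm C) (xpq : x \in fv (Imp p q))
    (xp : x \in fv p) (xq : x \in fv q) :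
    AXm (Imp (All xpq) (Imp (All xp) (All xq)))
| ax_all_imp_r (x : var) (p q : Fm C) (xpq : x \in fv (Imp p q))
    (xq : x \in fv q) :
    x \notin fv p -> AXm (Imp (All xpq) (Imp p (All xq)))
| ax_box_all (x : var) (p : Fm C) (xp : x \in fv p)
    (xbp : x \in fv (Box p)) :
    AXm (Imp (Box (All xp)) (All xbp))
| ax_gen (x : var) (p : Fm C) (xp : x \in fv p) : AXm p -> AXm (All xp).

(** * Propositional domains and S3-models *)

Record prop_domain (C : constants) := PropDomain {
  carrier :> Type;
  TRUE : carrier -> Prop;
  NEC : carrier -> Prop;
  f_bot : carrier;
  f_top : carrier;
  f_box : carrier -> carrier;
  f_neg : carrier -> carrier;
  f_or : carrier -> carrier -> carrier;
  f_and : carrier -> carrier -> carrier;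
  f_imp : carrier -> carrier -> carrier;
  f_equ : carrier -> carrier -> carrier;
  f_all : (carrier -> carrier) -> carrier;
  Gam : C -> carrier;
  Gam_bot : Gam (c_bot C) = f_bot;
  Gam_top : Gam (c_top C) = f_top }.

Arguments TRUE {C} p _.
Arguments NEC {C} p _.
Arguments f_bot {C} p.
Arguments f_top {C} p.
Arguments f_all {C} p _.

Fixpoint rden (C : constants) (M : prop_domain C) (g : var -> M)
    (phi : raw C) : M :=
  match phi with
  | RVar x => g x
  | RConst c => Gam M c
  | RNeg p => f_neg (rden g p)
  | RImp p q => f_imp (rden g p) (rden g q)
  | ROr p q => f_or (rden g p) (rden g q)
  | RAnd p q => f_and (rden g p) (rden g q)
  | REqu p q => f_equ (rden g p) (rden g q)
  | RBox p => f_box (rden g p)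
  | RAll x p => f_all M (fun m => rden (upd g x m) p)
  end.

Definition den (C : constants) (M : prop_domain C) (g : var -> M)
  (p : Fm C) : M := rden g p.

Definition definable_by (C : constants) (M : prop_domain C) (p : Fm C)
    (x : var) (g : var -> M) (t : M -> M) : Prop :=
  forall m, t m = den (upd g x m) p.

Definition definable (C : constants) (M : prop_domain C) (t : M -> M) : Prop :=
  exists p x g, definable_by p x g t.

Definition le_dom (C : constants) (M : prop_domain C) (a b : M) : Prop :=
  NEC M (f_imp a b).

Definition sym_part (A : Type) (le : A -> A -> Prop) (a b : A) : Prop :=
  le a b /\ le b a.

Definition equiv_dom (C : constants) (M : prop_domain C) : M -> M -> Prop :=
  sym_part (@le_dom C M).

(* The laws [bp_orC] to [bp_imp] hold up to the symmetric part of [le]: they say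
   that the quotient is a Boolean algebra with implication [imp], and [bp_leE]
   that it is ordered by [le]. *)
Record boolean_prealgebra (A : Type) (bot top : A) (neg : A -> A)
    (or and imp : A -> A -> A) (le : A -> A -> Prop) : Prop := {
  bp_refl : forall a, le a a;
  bp_trans : forall a b c, le a b -> le b c -> le a c;
  bp_neg_congr : forall a a', sym_part le a a' -> sym_part le (neg a) (neg a');
  bp_or_congr : forall a a' b b', sym_part le a a' -> sym_part le b b' ->
    sym_part le (or a b) (or a' b');
  bp_and_congr : forall a a' b b', sym_part le a a' -> sym_part le b b' ->
    sym_part le (and a b) (and a' b');
  bp_imp_congr : forall a a' b b', sym_part le a a' -> sym_part le b b' ->
    sym_part le (imp a b) (imp a' b');
  bp_orC : forall a b, sym_part le (or a b) (or b a);
  bp_andC : forall a b, sym_part le (and a b) (and b a);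
  bp_orA : forall a b c, sym_part le (or a (or b c)) (or (or a b) c);
  bp_andA : forall a b c, sym_part le (and a (and b c)) (and (and a b) c);
  bp_orK : forall a b, sym_part le (or a (and a b)) a;
  bp_andK : forall a b, sym_part le (and a (or a b)) a;
  bp_andDor : forall a b c,
    sym_part le (and a (or b c)) (or (and a b) (and a c));
  bp_orDand : forall a b c,
    sym_part le (or a (and b c)) (and (or a b) (or a c));
  bp_or_bot : forall a, sym_part le (or a bot) a;
  bp_and_top : forall a, sym_part le (and a top) a;
  bp_or_neg : forall a, sym_part le (or a (neg a)) top;
  bp_and_neg : forall a, sym_part le (and a (neg a)) bot;
  bp_imp : forall a b, sym_part le (imp a b) (or (neg a) b);
  bp_leE : forall a b, le a b <-> sym_part le (and a b) a }.

Definition dom_prealgebra (C : constants) (M : prop_domain C) : Prop :=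
  boolean_prealgebra (f_bot M) (f_top M) (@f_neg C M) (@f_or C M)
    (@f_and C M) (@f_imp C M) (@le_dom C M).

Record dom_truth (C : constants) (M : prop_domain C) : Prop := {
  true_bot : ~ TRUE M (f_bot M);
  true_top : TRUE M (f_top M);
  true_imp : forall a b : M,
    TRUE M (f_imp a b) <-> (TRUE M a -> TRUE M b);
  true_neg : forall a : M, TRUE M (f_neg a) <-> ~ TRUE M a;
  true_and : forall a b : M, TRUE M (f_and a b) <-> TRUE M a /\ TRUE M b;
  true_or : forall a b : M, TRUE M (f_or a b) <-> TRUE M a \/ TRUE M b;
  true_box : forall a : M, TRUE M (f_box a) <-> NEC M a;
  true_equ : forall a b : M, TRUE M (f_equ a b) <-> a = b;
  true_all : forall t : M -> M, definable t ->
    (forall m, TRUE M (t m)) -> TRUE M (f_all M t) }.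

Record dom_nec_filter (C : constants) (M : prop_domain C) : Prop := {
  nec_true : forall a : M, NEC M a -> TRUE M a;
  nec_up : forall a b : M, NEC M a -> le_dom a b -> NEC M b;
  nec_and : forall a b : M, NEC M a -> NEC M b -> NEC M (f_and a b) }.

Record dom_laws (C : constants) (M : prop_domain C) : Prop := {
  law_equ_refl : forall a : M, le_dom (f_top M) (f_equ a a);
  law_equ_imp : forall a b : M, le_dom (f_equ a b) (f_imp a b);
  law_equ_subst : forall (a b : M) (t : M -> M), definable t ->
    le_dom (f_equ a b) (f_equ (t a) (t b));
  law_T : forall a : M, le_dom (f_box a) a;
  law_K : forall a b : M,
    le_dom (f_box (f_imp a b)) (f_imp (f_box a) (f_box b));
  law_S3 : forall a b : M,
    le_dom (f_box (f_imp a b)) (f_box (f_imp (f_box a) (f_box b)));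
  law_all_equ : forall p q x (g : var -> M) (t1 t2 t : M -> M),
    definable_by p x g t1 -> definable_by q x g t2 ->
    (forall a, t a = f_equ (t1 a) (t2 a)) ->
    le_dom (f_all M t) (f_equ (f_all M t1) (f_all M t2));
  law_all_imp : forall p q x (g : var -> M) (t1 t2 t : M -> M),
    definable_by p x g t1 -> definable_by q x g t2 ->
    (forall a, t a = f_imp (t1 a) (t2 a)) ->
    le_dom (f_all M t) (f_imp (f_all M t1) (f_all M t2));
  law_all_inst : forall (t : M -> M) (a : M), definable t ->
    le_dom (f_all M t) (t a);
  (* [b] is the denotation of a formula under an arbitrary assignment; the
     formula need not be closed. *)
  law_all_imp_r : forall r (h : var -> M) (b : M) q x (g : var -> M)
      (t' t : M -> M),
    b = den h r -> definable_by q x g t' ->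
    (forall a, t a = f_imp b (t' a)) ->
    le_dom (f_all M t) (f_imp b (f_all M t'));
  law_box_all : forall t : M -> M, definable t ->
    equiv_dom (f_box (f_all M t)) (f_all M (fun a => f_box (t a)));
  law_all_nec : forall t : M -> M, definable t ->
    (forall m, NEC M (t m)) -> NEC M (f_all M t) }.

Definition nec_nonempty (C : constants) (M : prop_domain C) : Prop :=
  exists a : M, NEC M a.

Record S3_model (C : constants) (M : prop_domain C) : Prop := {
  S3_prealgebra : nec_nonempty M -> dom_prealgebra M;
  S3_truth : dom_truth M;
  S3_filter : nec_nonempty M -> dom_nec_filter M;
  S3_laws : nec_nonempty M -> dom_laws M }.

(** * Simple models *)

Record simple_structure (C : constants) := SimpleStructure {
  s_carrier :> Type;
  s_TRUE : s_carrier -> Prop;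
  s_NEC : s_carrier -> Prop;
  s_Gam : C -> s_carrier;
  s_ext : (var -> s_carrier) -> Fm C -> s_carrier }.

Arguments s_TRUE {C} s _.
Arguments s_NEC {C} s _.

Record simple_model (C : constants) (S : simple_structure C) : Prop := {
  sm_nec_true : forall a : S, s_NEC S a -> s_TRUE S a;
  sm_var : forall (g : var -> S) x, s_ext g (Var x) = g x;
  sm_const : forall (g : var -> S) c, s_ext g (Const c) = s_Gam S c;
  sm_coincidence : forall (g g' : var -> S) (p : Fm C),
    (forall x, x \in fv p -> g x = g' x) -> s_ext g p = s_ext g' p;
  sm_subst : forall (g : var -> S) (sigma : var -> Fm C) (p : Fm C),
    s_ext g (Subst sigma p) = s_ext (fun x => s_ext g (sigma x)) p;
  sm_bot : ~ s_TRUE S (s_Gam S (c_bot C));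
  sm_top : s_TRUE S (s_Gam S (c_top C));
  sm_imp : forall (g : var -> S) p q, s_TRUE S (s_ext g (Imp p q)) <->
    (s_TRUE S (s_ext g p) -> s_TRUE S (s_ext g q));
  sm_neg : forall (g : var -> S) p, s_TRUE S (s_ext g (Neg p)) <->
    ~ s_TRUE S (s_ext g p);
  sm_and : forall (g : var -> S) p q, s_TRUE S (s_ext g (And p q)) <->
    s_TRUE S (s_ext g p) /\ s_TRUE S (s_ext g q);
  sm_or : forall (g : var -> S) p q, s_TRUE S (s_ext g (Or p q)) <->
    s_TRUE S (s_ext g p) \/ s_TRUE S (s_ext g q);
  sm_box : forall (g : var -> S) p, s_TRUE S (s_ext g (Box p)) <->
    s_NEC S (s_ext g p);
  sm_equ : forall (g : var -> S) p q, s_TRUE S (s_ext g (Equ p q)) <->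
    s_ext g p = s_ext g q;
  sm_all : forall (g : var -> S) x (p : Fm C) (xp : x \in fv p),
    s_TRUE S (s_ext g (All xp)) <->
    (forall a, s_TRUE S (s_ext (upd g x a) p));
  sm_nec_imp : forall (g : var -> S) p q, s_NEC S (s_ext g (Imp p q)) ->
    s_NEC S (s_ext g (Imp (Box p) (Box q)));
  sm_nec_all : forall (g : var -> S) x (p : Fm C) (xp : x \in fv p),
    s_NEC S (s_ext g (All xp)) -> forall a, s_NEC S (s_ext (upd g x a) p) }.

Definition admissible (C : constants) (S : simple_structure C) : Prop :=
  forall (g : var -> S) (p : Fm C), AXm p -> s_NEC S (s_ext g p).

Definition simple_of (C : constants) (M : prop_domain C) : simple_structure C :=
  SimpleStructure (TRUE M) (NEC M) (@Gam C M) (@den C M).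

(* Main.v *)
(** A model assigns denotations compositionally, so the coincidence and
    substitution properties follow by induction on formulas. Since [a <= b]
    means that [f_imp a b] is necessary, most axioms are necessary by the
    corresponding law of the model. A tautology is handled by expanding the top
    element over the literals of its variables: below each complete conjunction
    of literals, the value of a formula is decided by its truth table. *)

Require Import Defs.
From mathcomp Require Import all_boot.
From Stdlib Require Import FunctionalExtensionality.

Set Implicit Arguments.
Unset Strict Implicit.
Unset Printing Implicit Defensive.

(** * Tautologies in Boolean prealgebras *)

Fixpoint pvars (a : pform) : seq nat :=
  match a with
  | PVar x => [:: x]
  | PTop | PBot => [::]
  | PNeg a => pvars a
  | PImp a b | POr a b | PAnd a b => pvars a ++ pvars b
  end.

Section BooleanPrealgebra.

Variables (A : Type) (bot top : A) (neg : A -> A).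
Variables (or and imp : A -> A -> A) (le : A -> A -> Prop).
Hypothesis BA : boolean_prealgebra bot top neg or and imp le.

Let le_trans := bp_trans BA.
Arguments le_trans {a b c} _ _.

Lemma bp_le_orl a b : le a (or a b).
Proof. by apply/(bp_leE BA); exact: bp_andK BA a b. Qed.

Lemma bp_le_orr a b : le b (or a b).
Proof. exact: le_trans (bp_le_orl b a) (bp_orC BA b a).1. Qed.

Lemma bp_and_lel a b : le (and a b) a.
Proof. exact: le_trans (bp_le_orr a _) (bp_orK BA a b).1. Qed.

Lemma bp_and_ler a b : le (and a b) b.
Proof. exact: le_trans (bp_andC BA a b).1 (bp_and_lel b a). Qed.

(** Replacing [c] by the equivalent [and c a] inside [and c b] and reassociating gives
    [le c (and c (and a b))]. *)
Lemma bp_le_and a b c : le c a -> le c b -> le c (and a b).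
Proof.
move=> /(bp_leE BA)[_ ca] /(bp_leE BA)[_ cb].
have cc : sym_part le (and c a) c by split=> //; exact: bp_and_lel.
have bb : sym_part le b b by split; exact: bp_refl BA b.
apply: le_trans (bp_and_ler c (and a b)).
exact: le_trans cb (le_trans (bp_and_congr BA cc bb).2 (bp_andA BA c a b).2).
Qed.

(** Replacing [a] and [b] by their meets with [c], distributivity factors [c] out of the join. *)
Lemma bp_or_le a b c : le a c -> le b c -> le (or a b) c.
Proof.
move=> /(bp_leE BA) ac /(bp_leE BA) bc.
have sw d : sym_part le (and d c) d -> sym_part le (and c d) d.
  by case=> dc cd; split; [exact: bp_and_ler
    |exact: le_trans cd (bp_andC BA d c).1].
apply: le_trans (bp_and_lel c (or a b)).
exact: le_trans (bp_or_congr BA (sw _ ac) (sw _ bc)).2 (bp_andDor BA c a b).2.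
Qed.

Lemma bp_le_top a : le a top.
Proof. by apply/(bp_leE BA); exact: bp_and_top BA a. Qed.

Lemma bp_bot_le a : le bot a.
Proof. exact: le_trans (bp_le_orr a bot) (bp_or_bot BA a).1. Qed.

(** Distributivity of [and u] over [or a b]. Read as entailment, this is case analysis in a context
    [u], the rule from which the reasoning by cases below is built. *)
Lemma bp_or_elim u a b c :
  le u (or a b) -> le (and u a) c -> le (and u b) c -> le u c.
Proof.
move=> uab ac bc; apply: le_trans (bp_or_le ac bc).
exact: le_trans (bp_le_and (bp_refl BA u) uab) (bp_andDor BA u a b).1.
Qed.

Lemma bp_cases u a c : le (and u a) c -> le (and u (neg a)) c -> le u c.
Proof.
by apply: bp_or_elim; exact: le_trans (bp_le_top u) (bp_or_neg BA a).2.
Qed.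

Lemma bp_absurd u a c : le u a -> le u (neg a) -> le u c.
Proof.
move=> ua una; apply: le_trans (bp_bot_le c).
exact: le_trans (bp_le_and ua una) (bp_and_neg BA a).1.
Qed.

Lemma bp_le_neg u a : le (and u a) (neg a) -> le u (neg a).
Proof. by move=> h; apply: bp_cases h _; exact: bp_and_ler. Qed.

Lemma bp_and_le u a b : le u b -> le (and u a) b.
Proof. exact: le_trans (bp_and_lel u a). Qed.

Fixpoint pval (e : nat -> A) (a : pform) : A :=
  match a with
  | PVar x => e x
  | PTop => top
  | PBot => bot
  | PNeg a => neg (pval e a)
  | PImp a b => imp (pval e a) (pval e b)
  | POr a b => or (pval e a) (pval e b)
  | PAnd a b => and (pval e a) (pval e b)
  end.

Definition literal (b : bool) (a : A) : A := if b then a else neg a.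

(** An algebraic form of Kalmár's lemma, by induction on [a]. Since [u] is any lower bound of the
    relevant literals, rather than their exact conjunction, the same [u] serves for all
    subformulas. *)
Lemma pval_decided (e : nat -> A) (v : nat -> bool) (u : A) (a : pform) :
  (forall x, x \in pvars a -> le u (literal (v x) (e x))) ->
  le u (literal (peval v a) (pval e a)).
Proof.
have split2 s t : (forall x, x \in s ++ t -> le u (literal (v x) (e x))) ->
    (forall x, x \in s -> le u (literal (v x) (e x))) /\
    (forall x, x \in t -> le u (literal (v x) (e x))).
  by move=> h; split=> x xs; apply: h; rewrite mem_cat xs ?orbT.
elim: a => [x|||a IHa|a IHa b IHb|a IHa b IHb|a IHa b IHb] /=.
- by apply; rewrite inE.
- by move=> _; exact: bp_le_top.
- by move=> _; apply: bp_le_neg; apply: le_trans (bp_bot_le _); exact: bp_and_ler.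
- move=> /IHa; case: (peval v a) => //= ua; apply: bp_le_neg.
  exact: bp_absurd (bp_and_le _ ua) (bp_and_ler _ _).
- case/split2 => /IHa + /IHb; case: (peval v a) => /= ua; last first.
    by move=> _; apply: le_trans (bp_imp BA _ _).2; exact: le_trans (bp_le_orl _ _).
  case: (peval v b) => /= ub.
    by apply: le_trans (bp_imp BA _ _).2; exact: le_trans (bp_le_orr _ _).
  (* Here [a] is true and [b] false: below [u], the implication splits into [neg a] or [b], and each
     disjunct contradicts a literal above [u]. *)
  apply: bp_le_neg; apply: bp_or_elim.
  + exact: le_trans (bp_and_ler _ _) (bp_imp BA _ _).1.
  + exact: bp_absurd (bp_and_le _ (bp_and_le _ ua)) (bp_and_ler _ _).
  + exact: bp_absurd (bp_and_ler _ _) (bp_and_le _ (bp_and_le _ ub)).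
- case/split2 => /IHa + /IHb; case: (peval v a) => /= ua.
    by move=> _; exact: le_trans ua (bp_le_orl _ _).
  case: (peval v b) => /= ub; first exact: le_trans ub (bp_le_orr _ _).
  apply: bp_le_neg; apply: bp_or_elim (bp_and_ler _ _) _ _.
  + exact: bp_absurd (bp_and_ler _ _) (bp_and_le _ (bp_and_le _ ua)).
  + exact: bp_absurd (bp_and_ler _ _) (bp_and_le _ (bp_and_le _ ub)).
- case/split2 => /IHa + /IHb; case: (peval v a) => /= ua; last first.
    move=> _; apply: bp_le_neg; apply: bp_absurd (bp_and_le _ ua).
    exact: le_trans (bp_and_ler _ _) (bp_and_lel _ _).
  case: (peval v b) => /= ub; first exact: bp_le_and.
  apply: bp_le_neg; apply: bp_absurd (bp_and_le _ ub).
  exact: le_trans (bp_and_ler _ _) (bp_and_ler _ _).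
Qed.

Lemma pval_tautology (e : nat -> A) (a : pform) :
  tautology a -> le top (pval e a).
Proof.
move=> taut.
(* [s] lists the variables whose literals [u] does not yet decide. *)
have expand (s : seq nat) : forall u v,
    (forall x, x \in pvars a -> x \notin s -> le u (literal (v x) (e x))) ->
    le u (pval e a).
  elim: s => [|y s IHs] u v huv.
    (* With every variable decided, [taut v] makes the literal positive. *)
    by have := @pval_decided e v u a; rewrite (taut v); apply=> x xa; apply: huv.
  (* Meeting [u] with a literal of [y] decides [y]; [v] is updated to match the sign chosen, and
     [bp_cases] then joins the two signs. *)
  have step b : le (and u (literal b (e y))) (pval e a).
    apply: (IHs _ (upd v y b)) => x xa xs; rewrite /upd.
    case: eqP => [->|/eqP xy]; first exact: bp_and_ler.
    by apply/bp_and_le/huv => //; rewrite inE negb_or xy.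
  exact: bp_cases (step true) (step false).
(* At the start no variable is decided, so the hypothesis on literals is vacuous and the valuation
   arbitrary. *)
by apply: (expand (pvars a) top xpredT) => x ->.
Qed.

End BooleanPrealgebra.

(** * Denotations *)

Lemma rden_coincidence (C : constants) (M : prop_domain C) (phi : raw C)
    (g g' : nat -> M) :
  (forall x, x \in fv phi -> g x = g' x) -> rden g phi = rden g' phi.
Proof.
elim: phi g g' => [y|c|p IHp|p IHp q IHq|p IHp q IHq|p IHp q IHq|p IHp q IHq
  |p IHp|y p IHp] g g' //= gg'; try (by rewrite (IHp g g') ?(IHq g g') // =>
    x xp; apply: gg'; rewrite ?mem_cat xp ?orbT).
- by apply: gg'; rewrite inE.
congr f_all; apply: functional_extensionality => m; apply: IHp => x xp.
by rewrite /upd; case: eqP => // /eqP xy; rewrite gg' // mem_filter xy.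
Qed.

Lemma rden_rsubst (C : constants) (M : prop_domain C) (phi : raw C)
    (sigma : nat -> raw C) (g : nat -> M) :
  rden g (rsubst sigma phi) = rden (fun x => rden g (sigma x)) phi.
Proof.
elim: phi sigma g => [y|c|p IHp|p IHp q IHq|p IHp q IHq|p IHp q IHq
  |p IHp q IHq|p IHp|x p IHp] sigma g //=; rewrite ?IHp ?IHq //.
set s := flatten _; set y := if _ then _ else _.
(* Renamed or not, the binder avoids [s], so updating at [y] leaves the value of each relevant
   [sigma z] unchanged. *)
have ys : y \notin s by rewrite /y; case: ifP => [_|/negbT//]; exact: freshP.
congr f_all; apply: functional_extensionality => m; rewrite IHp.
apply: rden_coincidence => z zp; rewrite /upd.
case: eqP => [_|/eqP zx] /=; first by rewrite eqxx.
apply: rden_coincidence => w wz; case: eqP => // wy.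
case/negP: ys; rewrite -wy; apply/flattenP; exists (fv (sigma z)) => //.
by apply: map_f; rewrite mem_filter zx.
Qed.

Lemma den_Subst1 (C : constants) (M : prop_domain C) (g : nat -> M) (x : nat)
    (p q : Fm C) :
  den g (Subst1 x q p) = den (upd g x (den g q)) p.
Proof.
rewrite /den /= rden_rsubst; apply: rden_coincidence => z _.
by rewrite /upd; case: eqP.
Qed.

Lemma den_alpha (C : constants) (M : prop_domain C) (p q : Fm C) :
  alpha p q -> forall g : nat -> M, den g p = den g q.
Proof.
elim=> {p q} [//|p q _ IH g|p q r _ IH1 _ IH2 g|p p' _ IH g|p p' _ IH g
  |p p' q q' _ IH1 _ IH2 g|p p' q q' _ IH1 _ IH2 g|p p' q q' _ IH1 _ IH2 g
  |p p' q q' _ IH1 _ IH2 g|x p p' xp xp' _ IH g|x y p xp yp yNp g].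
- by rewrite IH.
- by rewrite IH1.
- exact: (congr1 (@f_neg C M) (IH g)).
- exact: (congr1 (@f_box C M) (IH g)).
- exact: (congr2 (@f_imp C M) (IH1 g) (IH2 g)).
- exact: (congr2 (@f_or C M) (IH1 g) (IH2 g)).
- exact: (congr2 (@f_and C M) (IH1 g) (IH2 g)).
- exact: (congr2 (@f_equ C M) (IH1 g) (IH2 g)).
- congr (f_all M); apply: functional_extensionality => m; exact: IH.
- congr (f_all M); apply: functional_extensionality => m.
  (* By [den_Subst1] the right side evaluates [p] with both [x] and [y] sent to [m]. The two
     assignments can differ only at [y] distinct from [x], and such a [y] is not free in [p]. *)
  rewrite -[RHS]/(den (upd g y m) (Subst1 x (Var y) p)) den_Subst1.
  apply: rden_coincidence => z zp; rewrite /upd /den /= eqxx.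
  case: eqP => // /eqP zx; case: eqP => // zy.
  by case/negP: yNp; rewrite -zy mem_filter zx.
Qed.

Lemma den_pinst (C : constants) (M : prop_domain C) (g : nat -> M)
    (sigma : nat -> Fm C) (a : pform) :
  den g (pinst sigma a) =
  pval (f_bot M) (f_top M) (@f_neg C M) (@f_or C M) (@f_and C M) (@f_imp C M)
    (fun x => den g (sigma x)) a.
Proof.
rewrite /den; elim: a => //= [||a ->|a -> b ->|a -> b ->|a -> b ->] //.
- exact: Gam_top.
- exact: Gam_bot.
Qed.

Lemma definable_den (C : constants) (M : prop_domain C) (g : nat -> M) (x : nat)
    (p : Fm C) :
  definable (fun m => den (upd g x m) p).
Proof. by exists p, x, g. Qed.

(** * S3-models *)

(** Any necessary element lies below the top, and [NEC] is upward closed. *)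
Lemma nec_top (C : constants) (M : prop_domain C) :
  S3_model M -> nec_nonempty M -> NEC M (f_top M).
Proof.
move=> SM ne; case: (ne) => a na.
exact: (nec_up (S3_filter SM ne) na (bp_le_top (S3_prealgebra SM ne) a)).
Qed.

Lemma true_le (C : constants) (M : prop_domain C) (a b : M) :
  S3_model M -> nec_nonempty M -> le_dom a b -> TRUE M a -> TRUE M b.
Proof.
by move=> SM ne /(nec_true (S3_filter SM ne))/(true_imp (S3_truth SM)).
Qed.

Lemma S3_simple (C : constants) (M : prop_domain C) :
  S3_model M -> nec_nonempty M -> simple_model (simple_of M).
Proof.
move=> SM ne; have tr := S3_truth SM; have fi := S3_filter SM ne.
have la := S3_laws SM ne.
split=> //=.
- exact: nec_true fi.
- by move=> g g' p; exact: rden_coincidence.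
- by move=> g sigma p; exact: rden_rsubst.
- by rewrite Gam_bot; exact: true_bot tr.
- by rewrite Gam_top; exact: true_top tr.
- by move=> g p q; exact: true_imp tr _ _.
- by move=> g p; exact: true_neg tr _.
- by move=> g p q; exact: true_and tr _ _.
- by move=> g p q; exact: true_or tr _ _.
- by move=> g p; exact: true_box tr _.
- by move=> g p q; exact: true_equ tr _ _.
- move=> g x p xp; split=> [h a|h].
    exact: (true_le SM ne (law_all_inst la a (definable_den g x p)) h).
  exact: (true_all tr (definable_den g x p) h).
(* An element is necessary exactly when its box is true, so the S3 law is applied to boxed elements
   as an implication between truths. *)
- move=> g p q /(true_box tr)/(true_le SM ne (law_S3 la _ _)).
  by move/(true_box tr).
- move=> g x p xp h a.
  exact: (nec_up fi h (law_all_inst la a (definable_den g x p))).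
Qed.

Lemma S3_admissible (C : constants) (M : prop_domain C) :
  S3_model M -> nec_nonempty M -> admissible (simple_of M).
Proof.
move=> SM ne g p ax; have fi := S3_filter SM ne; have la := S3_laws SM ne.
(* The assignment is generalized because the generalization rule uses the induction hypothesis at
   all updates of [g]. *)
elim: ax g => {p} [a sigma taut|p|p q|p q|p q pq|p q|x p q q' xp|x p q xp
  |x p q xpq xp xq|x p q xpq xq xNp|x p xp xbp|x p xp _ IH] g /=.
- rewrite den_pinst; apply: (nec_up fi (nec_top SM ne)).
  exact: pval_tautology (S3_prealgebra SM ne) _ _ taut.
- exact: law_T la _.
- exact: law_K la _ _.
- exact: law_S3 la _ _.
- apply: (nec_up fi (nec_top SM ne)).
  rewrite -[X in le_dom _ X]/(f_equ (den g p) (den g q)) (den_alpha pq).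
  exact: law_equ_refl la _.
- exact: law_equ_imp la _ _.
- rewrite -[X in NEC M X]/(f_imp (f_equ (den g q) (den g q'))
    (f_equ (den g (Subst1 x q p)) (den g (Subst1 x q' p)))) !den_Subst1.
  exact: (law_equ_subst la (den g q) (den g q') (definable_den g x p)).
- rewrite -[X in NEC M X]/(f_imp (den g (All xp)) (den g (Subst1 x q p))).
  rewrite den_Subst1; exact: (law_all_inst la (den g q) (definable_den g x p)).
- by apply: (law_all_imp la (p := p) (q := q) (x := x) (g := g)).
(* The constant [b] of the law is the value of [p] under [g]; as [x] is not free in [p], updating
   [g] at [x] does not change it. *)
- apply: (law_all_imp_r la (r := p) (h := g) (q := q) (x := x) (g := g)) => // a.
  congr f_imp; apply: rden_coincidence => z zp; rewrite /upd.
  by case: eqP => // zx; rewrite -zx zp in xNp.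
(* The first half of the equivalence is the converse Barcan inequality. *)
- exact: (law_box_all la (definable_den g x p)).1.
- by apply: (law_all_nec la (definable_den g x p)) => m; exact: IH.
Qed.

Theorem theorem42 (C : constants) (M : prop_domain C) :
  S3_model M -> nec_nonempty M ->
  simple_model (simple_of M) /\ admissible (simple_of M).
Proof. by move=> SM ne; split; [exact: S3_simple|exact: S3_admissible]. Qed.
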